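(* Let $f=\sum_{\nu\in\mathbb{Z}^d}a_\nu t^\nu\in M_r(\mathbb{Z}[t_1^{\pm1},\dots,t_d^{\pm1}])$ be such that the matrix $f(z)$ is invertible for every $z\in T_p^d$. Then, for the sequence $\Gamma_n=(n\mathbb{Z})^d$ with $n\to\infty$ running through integers prime to $p$, the $p$-adic entropy $h_p(f)=\lim_{n}\frac{1}{n^d}\log_p|\mathrm{Fix}_{\Gamma_n}(X_f)|$ of the $\mathbb{Z}^d$-action on $X_f$ exists and equals $m_p(\det f)=\int_{T_p^d}\log_p(\det f)(z)$ (Snirelman integral).
   Context: $\mathbb{C}_p$ is the completion of an algebraic closure $\overline{\mathbb{Q}}_p$ of $\mathbb{Q}_p$, $T_p^d=\{z\in\mathbb{C}_p^d:|z_i|_p=1\}$, $\log_p:\mathbb{C}_p^*\to\mathbb{C}_p$ the branch of the $p$-adic logarithm with $\log_p(p)=0$. The Snirelman integral of continuous $F:T_p^d\to\mathbb{C}_p$ is $\lim_{N\to\infty,(N,p)=1}N^{-d}\sum_{\zeta\in\mu_N^d}F(\zeta)$, $\mu_N$ the $N$-th roots of unity in $\overline{\mathbb{Q}}_p$. With $\Gamma=\mathbb{Z}^d$ and $T=(\mathbb{R}/\mathbb{Z})^r$, $X_f\subset T^{\Gamma}$ is the closed subgroup of all $(x_{\mu})_{\mu\in\mathbb{Z}^d}$ (row vectors) with $\sum_{\mu}x_{\mu}a^T_{\mu-\lambda}=0$ in $T$ for all $\lambda\in\mathbb{Z}^d$ ($a^T$ transpose), with action $\lambda\cdot(x_\mu)=(x_{\mu-\lambda})$;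 $\mathrm{Fix}_{\Gamma_n}(X_f)$ is the set of points fixed by all of $\Gamma_n$. *)

(* Defs.v *)
From HB Require Import structures.
From mathcomp Require Import all_boot all_order all_algebra.
From mathcomp Require Import all_classical all_reals.
Set Implicit Arguments. Unset Strict Implicit. Unset Printing Implicit Defensive.
Import Order.TTheory GRing.Theory Num.Theory.
Local Open Scope ring_scope.
Local Open Scope classical_set_scope.

(* [av] is an absolute value on the algebraically closed field K such that:
   it is ultrametric, restricts to the p-adic absolute value |.|_p on Q
   (|p| = 1/p, |n| = 1 for n prime to p), K is complete for it, and the
   elements algebraic over Q are dense in K.  Such (K, av) is isometrically
   isomorphic to C_p = completion of an algebraic closure of Q_p. *)

Definition av_cauchy (R : realType) (K : fieldType) (av : K -> R) (u : nat -> K) :=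
  forall eps : R, 0 < eps -> exists M : nat,
    forall m n : nat, (M <= m)%N -> (M <= n)%N -> av (u m - u n) < eps.

Definition av_cvg (R : realType) (K : fieldType) (av : K -> R) (u : nat -> K) (l : K) :=
  forall eps : R, 0 < eps -> exists M : nat,
    forall n : nat, (M <= n)%N -> av (u n - l) < eps.

Definition algebraic_over_Q (K : fieldType) (y : K) :=
  exists q : {poly int}, q != 0 /\ root (map_poly (fun c : int => c%:~R) q) y.

Record is_Cp (p : nat) (R : realType) (K : closedFieldType) (av : K -> R) : Prop := {
  av_ge0 : forall x, 0 <= av x;
  av_eq0 : forall x, av x = 0 <-> x = 0;
  av_mul : forall x y, av (x * y) = av x * av y;
  av_ultra : forall x y, av (x + y) <= Num.max (av x) (av y);
  av_p : av p%:R = (p%:R)^-1;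
  av_coprime : forall n : nat, coprime n p -> av n%:R = 1;
  av_complete : forall u : nat -> K, av_cauchy av u -> exists l, av_cvg av u l;
  av_dense : forall (x : K) (eps : R), 0 < eps ->
     exists y : K, algebraic_over_Q y /\ av (x - y) < eps
}.

(* the homomorphism C_p^* -> C_p given by the usual series on the disc
   |x - 1| < 1 and normalized by log_p p = 0 (this determines it uniquely). *)
Definition is_plog (p : nat) (R : realType) (K : fieldType) (av : K -> R)
    (lg : K -> K) : Prop :=
  [/\ forall x y : K, x != 0 -> y != 0 -> lg (x * y) = lg x + lg y,
      lg p%:R = 0 &
      forall x : K, av (x - 1) < 1 ->
        av_cvg av (fun N => \sum_(n < N) (-1) ^+ n * (x - 1) ^+ n.+1 / n.+1%:R)
               (lg x)].

Definition av_cvg_cop (p : nat) (R : realType) (K : fieldType) (av : K -> R)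
    (u : nat -> K) (l : K) :=
  forall eps : R, 0 < eps -> exists M : nat,
    forall n : nat, (M <= n)%N -> coprime n p -> av (u n - l) < eps.

(* f = \sum_nu a_nu t^nu, with nu in Z^d (row vectors 'rV[int]_d),
   a_nu in M_r(Z), and a_nu = 0 for nu outside the finite list S. *)
Definition lpoly_eval (K : fieldType) (d r : nat) (a : 'rV[int]_d -> 'M[int]_r)
    (S : seq 'rV[int]_d) (z : 'I_d -> K) : 'M[K]_r :=
  \sum_(nu <- undup S)
     (\prod_(i < d) z i ^ (nu ord0 i)) *: map_mx (fun c : int => c%:~R) (a nu).

(* T = (R/Z)^r, an element of T is represented by its unique representative
   in [0,1)^r (a function 'I_r -> R).  A point of T^{Z^d} is a function
   x : Z^d -> T.  x in X_f iff for all lambda, sum_mu x_mu a^T_{mu-lambda} = 0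
   in T; writing mu = lambda + nu (a_{nu} = 0 outside S), the j-th coordinate
   is sum_{nu in S} sum_k x_{lambda+nu}(k) a_nu(j,k), which must be an integer.
   x is fixed by Gamma_n = (nZ)^d iff x_{mu - lambda} = x_mu for lambda in (nZ)^d. *)
Definition fixXf (R : realType) (d r : nat) (a : 'rV[int]_d -> 'M[int]_r)
    (S : seq 'rV[int]_d) (n : nat) : set ('rV[int]_d -> 'I_r -> R) :=
  [set x : 'rV[int]_d -> 'I_r -> R | (forall (mu : 'rV[int]_d) (k : 'I_r), 0 <= x mu k /\ x mu k < 1) /\
           (forall lam : 'rV[int]_d, (forall j : 'I_d, (n%:Z %| lam ord0 j)%Z) ->
              forall mu, x (mu - lam) = x mu) /\
           (forall (lam : 'rV[int]_d) (j : 'I_r),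
              (\sum_(nu <- undup S) \sum_(k < r) x (lam + nu) k * (a nu j k)%:~R)
                 \is a Num.int)].

(* Main.v *)
(* The points of period n form the torsion group {y in (R/Z)^D : A y = 0}, where A is
   the matrix of f acting on Z[Z^d / n Z^d]^r; it has |det A| elements, and the Fourier
   matrix shows that det A is the product of det f over the n-th roots of unity. Hence
   the two sequences of the theorem are equal, and only the existence of the Snirelman
   integral of log det f remains.
   Substituting t_i = s^(B^i) with a suitable B turns det f into a one-variable
   polynomial with the same coefficients and no root of absolute value 1; such a
   polynomial has a unique coefficient of maximal absolute value. So on the torus
   det f = c t^nu (1 + h) with |h| <= rho < 1. The logarithm vanishes at roots of unity,
   the series of log (1 + h) converges uniformly, and the averages of a Laurent polynomial
   over the N-th roots of unity do not depend on N for N large. *)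
Require Import Defs.
From HB Require Import structures.
From mathcomp Require Import all_boot all_order all_algebra.
From mathcomp Require Import all_classical all_reals.
From mathcomp Require Import perm ring lra.
Import Order.TTheory GRing.Theory Num.Theory.
Local Open Scope ring_scope.
Local Open Scope classical_set_scope.
Local Open Scope card_scope.

Set Implicit Arguments.
Unset Strict Implicit.
Unset Printing Implicit Defensive.

(** * Points of a real torus killed by an integer matrix *)

Section CountingLatticePoints.

Lemma card_eq_finType (T : finType) : [set: T] #= `I_#|T|.
Proof.
apply/card_set_bijP; exists (fun x => val (enum_rank x)); split.
- by move=> x _ /=.
- by move=> x y _ _ /val_inj; apply: enum_rank_inj.
- by move=> i /= i_lt; exists (enum_val (Ordinal i_lt)); rewrite ?enum_valK.
Qed.

Variable R : realType.

Definition frac_mx m n (y : 'M[R]_(m, n)) : 'M[R]_(m, n) :=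
  \matrix_(i, j) (y i j - (Num.floor (y i j))%:~R).

Definition in_unit_box m n (y : 'M[R]_(m, n)) := forall i j, 0 <= y i j /\ y i j < 1.

Lemma frac_mx_int m n (y : 'M[R]_(m, n)) : y - frac_mx y \is a mxOver Num.int.
Proof.
by apply/mxOverP => i j; rewrite !mxE opprB addrC subrK intr_int.
Qed.

Lemma frac_mx_box m n (y : 'M[R]_(m, n)) : in_unit_box (frac_mx y).
Proof.
move=> i j; rewrite mxE; have /andP[lo hi] := Num.Theory.floor_itv (y i j).
by rewrite subr_ge0 lo ltrBlDl (lt_le_trans hi) // intrD.
Qed.

Lemma int_small_eq0 (x : R) : x \is a Num.int -> -1 < x < 1 -> x = 0.
Proof.
case/intrP => m ->; rewrite -ltr_norml -intr_norm ltrz1 -abszE ltz_nat ltnS leqn0 absz_eq0.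
by move/eqP ->.
Qed.

Lemma unit_box_eq m n (y w : 'M[R]_(m, n)) : in_unit_box y -> in_unit_box w ->
  y - w \is a mxOver Num.int -> y = w.
Proof.
move=> yB wB /mxOverP yw; apply/matrixP => i j; apply/eqP; rewrite -subr_eq0; apply/eqP.
have [[y0 y1] [w0 w1]] := (yB i j, wB i j).
by apply: int_small_eq0; [have := yw i j; rewrite !mxE | apply/andP; split; lra].
Qed.

Lemma int_mx_intr m n (B : 'M[int]_(m, n)) : map_mx (intr : int -> R) B \is a mxOver Num.int.
Proof. by apply/mxOverP => i j; rewrite mxE intr_int. Qed.

Lemma int_mxB m n (y w : 'M[R]_(m, n)) :
  y \is a mxOver Num.int -> w \is a mxOver Num.int -> y - w \is a mxOver Num.int.
Proof.
by move=> /mxOverP yZ /mxOverP wZ; apply/mxOverP => i j; rewrite !mxE rpredB.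
Qed.

Lemma int_mx_mul m n k (B : 'M[int]_(m, n)) (y : 'M[R]_(n, k)) :
  y \is a mxOver Num.int -> map_mx intr B *m y \is a mxOver Num.int.
Proof. by move=> yZ; apply: mxOverM => //; apply: int_mx_intr. Qed.

Definition torus_kernel n (A : 'M[int]_n) : set 'cV[R]_n :=
  [set y | in_unit_box y /\ map_mx intr A *m y \is a mxOver Num.int].

Lemma absz_det_unitmx n (B : 'M[int]_n) : B \in unitmx -> absz (\det B) = 1%N.
Proof.
move=> Bu; have /(congr1 absz)/eqP : \det B * \det (invmx B) = 1.
  by rewrite -det_mulmx mulmxV // det1.
by rewrite abszM muln_eq1 => /andP[/eqP].
Qed.

(* With [A = L diag(e) U] in Smith normal form, the points are the classes of [U^-1 v]
   for [v] having coordinates [k_i / e_i] with [0 <= k_i < |e_i|]. *)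
Lemma card_torus_kernel n (A : 'M[int]_n) :
  \det A != 0 -> torus_kernel A #= `I_(absz (\det A)).
Proof.
have [L Lu [U Uu [s _ ->]]] := int_Smith_normal_form A.
have -> : \matrix_(i < n, j < n) (s`_i *+ (i == j :> nat)) = diag_mx (\row_i s`_i).
  by apply/matrixP => i j; rewrite !mxE.
move: (\row_(i < n) s`_i) => e.
rewrite !det_mulmx det_diag !abszM !absz_det_unitmx // mul1n muln1.
rewrite !mulf_eq0 => /norP[/norP[_ /prodf_neq0 e0] _].
have {}e0 i : e 0 i != 0 by apply: e0.
have er0 i : (e 0 i)%:~R != 0 :> R by rewrite intr_eq0.
pose T := {dffun forall i : 'I_n, 'I_(absz (e 0 i))}.
have -> : absz (\prod_i e 0 i) = #|T|.
  rewrite card_dep_ffun [RHS]foldrE big_image /= (big_morph absz abszM absz1).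
  by apply: eq_bigr => i _; rewrite [RHS]card_ord.
pose M (B : 'M[int]_n) : 'M[R]_n := map_mx intr B.
pose v (k : T) : 'cV[R]_n := \col_i ((k i)%:R / (e 0 i)%:~R).
pose g k := frac_mx (M (invmx U) *m v k).
have MK y : M U *m (M (invmx U) *m y) = y by rewrite mulmxA -map_mxM mulmxV // map_mx1 mul1mx.
have MK' y : M (invmx U) *m (M U *m y) = y by rewrite mulmxA -map_mxM mulVmx // map_mx1 mul1mx.
have diagE (y : 'cV[R]_n) i j : (M (diag_mx e) *m y) i j = (e 0 i)%:~R * y i j.
  by rewrite /M map_diag_mx mul_diag_mx !mxE.
rewrite -(card_eqr (card_eq_finType T)) card_eq_sym.
suff /bijPex[f] : exists f, set_bij [set: T] (torus_kernel (L *m diag_mx e *m U)) f.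
  exact: pcard_eq f.
exists g; split.
- move=> k _; split; first exact: frac_mx_box.
  rewrite -[g k](subKr (M (invmx U) *m v k)) mulmxBr; apply: int_mxB; last first.
    by apply: int_mx_mul; apply: frac_mx_int.
  rewrite !map_mxM -!mulmxA MK; apply: int_mx_mul; apply/mxOverP => i j.
  by rewrite diagE !mxE mulrC divfK // -pmulrn intr_int.
- move=> k k' _ _ /(congr1 (mulmx (M U))) gk.
  have : v k - v k' \is a mxOver Num.int.
    rewrite -[v k]MK -[v k']MK -mulmxBr.
    rewrite -[M (invmx U) *m v k](subrK (g k)) -[M (invmx U) *m v k'](subrK (g k')).
    rewrite opprD addrACA mulmxDr [M U *m (g k - _)]mulmxBr gk subrr addr0.
    by apply: int_mx_mul; apply: int_mxB; apply: frac_mx_int.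
  move=> /mxOverP vk; apply/ffunP => i; apply/val_inj/eqP.
  have := vk i 0; rewrite !mxE -mulrBl => kZ.
  have /eqP : ((k i)%:R - (k' i)%:R) / (e 0 i)%:~R = 0 :> R.
    apply: int_small_eq0 => //; rewrite -ltr_norml normrM normfV -intr_norm.
    rewrite ltr_pdivrMr ?mul1r ?normr_gt0 // ?ltr0z ?normr_gt0 //.
    rewrite -abszE -pmulrn ltr_norml.
    have := ltn_ord (k i); have := ltn_ord (k' i).
    rewrite -!(ltr_nat R) => ? ?; have := ler0n R (k i); have := ler0n R (k' i) => ? ?.
    by apply/andP; split; lra.
  by rewrite mulf_eq0 invr_eq0 (negPf (er0 i)) orbF subr_eq0 eqr_nat.
(* Surjectivity: cancelling L makes each e_i w_i an integer m_i. The digit k_i is m_i mod e_i, and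
   the quotient only shifts w by an integer vector. *)
- move=> y [yB Ay]; pose w := M U *m y.
  have /mxOverP wZ : M (diag_mx e) *m w \is a mxOver Num.int.
    have := int_mx_mul (invmx L) Ay.
    by rewrite mulmxA -map_mxM -!mulmxA mulKmx // map_mxM -mulmxA.
  pose m i := Num.floor ((e 0 i)%:~R * w i 0).
  have mE i : (m i)%:~R = (e 0 i)%:~R * w i 0 by apply: floorK; rewrite -diagE.
  have lt_k i : (absz (m i %% e 0%R i)%Z < absz (e 0%R i))%N.
    by rewrite -ltz_nat !abszE ger0_norm ?modz_ge0 // ltz_mod.
  exists ([ffun i => Ordinal (lt_k i)] : T) => //.
  apply: unit_box_eq => //; first exact: frac_mx_box.
  set k := finfun _.
  have -> : g k - y = M (invmx U) *m (v k - w) - (M (invmx U) *m v k - g k).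
    by rewrite mulmxBr MK' opprB [RHS]addrC subrKA.
  apply: int_mxB; last exact: frac_mx_int.
  apply: int_mx_mul; apply/mxOverP => i j.
  rewrite mxE [v k i j]mxE [(- w) i j]mxE ffunE /= ord1.
  have -> : w i 0 = (m i)%:~R / (e 0 i)%:~R by rewrite mE mulrC mulKf.
  rewrite -mulrBl pmulrn abszE ger0_norm ?modz_ge0 // -intrB /modz addrAC subrr add0r.
  by rewrite -mulNr intrM mulfK // intr_int.
Qed.

End CountingLatticePoints.

(** * Periodic points and the periodized matrix of f *)

Section Periodization.
Variables (d r n : nat) (a : 'rV[int]_d -> 'M[int]_r) (S : seq 'rV[int]_d).
Local Notation T := {ffun 'I_d -> 'I_n.+1}.
Implicit Types (lam mu nu : 'rV[int]_d) (k : T).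

(** The period is [n.+1] throughout, which makes the residue type ['I_n.+1] inhabited and lets
    [vec_red] use [inord]. *)
Definition congr_vec lam mu := [forall i, (n.+1%:Z %| lam ord0 i - mu ord0 i)%Z].

Definition vec_lift k : 'rV[int]_d := \row_i (k i)%:Z.

Definition vec_red mu : T := [ffun i => inord (absz (mu ord0 i %% n.+1)%Z)].

Lemma val_vec_red mu i : (vec_red mu i)%:Z = (mu ord0 i %% n.+1)%Z.
Proof.
rewrite ffunE inordK; first by rewrite abszE ger0_norm ?modz_ge0.
by rewrite -ltz_nat abszE ger0_norm ?modz_ge0 // ltz_pmod.
Qed.

Lemma congr_vecP lam mu : reflect (vec_red lam = vec_red mu) (congr_vec lam mu).
Proof.
apply: (iffP forallP) => [dvd|eq_red i].
  apply/ffunP => i; apply/val_inj/eqP; rewrite -eqz_nat !val_vec_red.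
  by rewrite eqz_mod_dvd; apply: dvd.
by rewrite -eqz_mod_dvd -!val_vec_red eq_red.
Qed.

Lemma vec_liftK : cancel vec_lift vec_red.
Proof.
move=> k; apply/ffunP => i; apply/val_inj/eqP.
by rewrite -eqz_nat val_vec_red mxE modz_small // ltz_nat ltn_ord.
Qed.

Lemma vec_red_sub mu lam : (forall i, (n.+1%:Z %| lam ord0 i)%Z) ->
  vec_red (mu - lam) = vec_red mu.
Proof.
by move=> dvd; apply/congr_vecP/forallP => i; rewrite !mxE addrAC subrr add0r rpredN.
Qed.

Lemma congr_vec_lift_red mu : congr_vec mu (vec_lift (vec_red mu)).
Proof. by apply/congr_vecP; rewrite vec_liftK. Qed.

Lemma vec_red_addl lam nu : vec_red (vec_lift (vec_red lam) + nu) = vec_red (lam + nu).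
Proof.
apply/esym/congr_vecP/forallP => i; have /forallP/(_ i) := congr_vec_lift_red lam.
by rewrite !mxE opprD addrACA subrr addr0.
Qed.

(** All exponents nu leading from the class of lam to that of mu act alike on periodic points, so
    their coefficients are added. *)
Definition period_block lam mu : 'M[int]_r :=
  \sum_(nu <- undup S | congr_vec (lam + nu) mu) a nu.

Local Notation q := #|{: T}|.

(* The matrix of [f] acting on [Z[Z^d / n Z^d]^r]. *)
Definition period_mx : 'M[int]_(\sum_(i < q) r) :=
  \mxblock_(i < q, j < q) period_block (vec_lift (enum_val i)) (vec_lift (enum_val j)).

Lemma period_block_map (F : pzRingType) lam mu :
  map_mx intr (period_block lam mu) =
  \sum_(nu <- undup S | congr_vec (lam + nu) mu) map_mx intr (a nu) :> 'M[F]_r.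
Proof. exact: raddf_sum. Qed.

(** For given nu exactly one class k is that of [lam + nu], so exchanging the sums leaves one term
    per nu. *)
Lemma sum_period (V : zmodType) (F : 'rV[int]_d -> T -> V) lam :
  \sum_(k : T) \sum_(nu <- undup S | congr_vec (lam + nu) (vec_lift k)) F nu k =
  \sum_(nu <- undup S) F nu (vec_red (lam + nu)).
Proof.
under eq_bigr do rewrite big_mkcond /=.
rewrite exchange_big; apply: eq_bigr => nu _ /=.
rewrite (bigD1 (vec_red (lam + nu))) //= big1 ?addr0 => [|k kne].
  by rewrite (introT (congr_vecP _ _)) // vec_liftK.
by case: congr_vecP => //; rewrite vec_liftK => kE; rewrite kE eqxx in kne.
Qed.

Lemma map_mx_period_mx (F : pzRingType) :
  map_mx intr period_mx = \mxblock_(i < q, j < q)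
    (map_mx intr (period_block (vec_lift (enum_val i)) (vec_lift (enum_val j)))) :> 'M[F]__.
Proof. by apply/matrixP => i j; rewrite !mxE. Qed.

Section FixedPoints.
Variable R : realType.

Definition spread (y : 'cV[R]_(\sum_(i < q) r)) mu (k : 'I_r) : R :=
  submxcol y (enum_rank (vec_red mu)) k 0.

(** Grouping the nu by the class of [lam + nu] turns the relations of X_f on periodic points into
    the rows of [period_mx]. *)
Lemma period_mx_spread (y : 'cV[R]_(\sum_(i < q) r)) lam j :
  \sum_(nu <- undup S) \sum_(k < r) spread y (lam + nu) k * (a nu j k)%:~R =
  submxcol (map_mx intr period_mx *m y) (enum_rank (vec_red lam)) j 0.
Proof.
rewrite -[in RHS](submxcolK y) map_mx_period_mx mul_mxblock_mxrow mxcolK enum_rankK.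
rewrite summxE [RHS](reindex enum_rank) /=; last exact/onW_bij/enum_rank_bij.
transitivity (\sum_(k : T)
   \sum_(nu <- undup S | congr_vec (vec_lift (vec_red lam) + nu) (vec_lift k))
   \sum_(l < r) submxcol y (enum_rank k) l 0 * (a nu j l)%:~R).
  by rewrite sum_period; under [RHS]eq_bigr do rewrite vec_red_addl.
apply: eq_bigr => k _; rewrite enum_rankK period_block_map mulmx_suml summxE.
apply: eq_bigr => nu _; rewrite mxE; apply: eq_bigr => l _.
by rewrite [map_mx _ _ _ _]mxE mulrC.
Qed.

(** [spread] is injective and maps the torus kernel of [period_mx] onto the fixed points, which
    reduces the count to [card_torus_kernel]. *)
Lemma card_fixXf : \det period_mx != 0 ->
  @fixXf R d r a S n.+1 #= `I_(absz (\det period_mx)).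
Proof.
move=> /(card_torus_kernel R) card_ker; apply: card_eq_trans card_ker.
have spread_inj : injective spread.
  move=> y y' yy'; apply/mxcolP => i; apply/matrixP => k z; rewrite ord1.
  have := congr1 (fun x => x (vec_lift (enum_val i)) k) yy'.
  by rewrite /spread vec_liftK enum_valK.
suff -> : @fixXf R d r a S n.+1 = spread @` (@torus_kernel R _ period_mx).
  by apply: inj_card_eq => y y' _ _; apply: spread_inj.
apply/seteqP; split=> [x [xB [xP xZ]]|_ [y [yB /mxOverP yZ] <-]]; last first.
  split; first by move=> mu k; rewrite /spread mxE; apply: yB.
  split=> [lam dvd mu|lam j]; first by rewrite /spread vec_red_sub.
  by rewrite period_mx_spread mxE.
pose y : 'cV[R]_(\sum_(i < q) r) := \mxcol_(i < q) \col_k x (vec_lift (enum_val i)) k.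
have spread_y : spread y = x.
  apply/funext => mu; apply/funext => k; rewrite /spread mxcolK mxE enum_rankK.
  congr (_ k); rewrite -[vec_lift _](subKr mu) xP // => i.
  by have /forallP/(_ i) := congr_vec_lift_red mu; rewrite !mxE.
exists y => //; split.
  by move=> i j; rewrite !mxE; apply: xB.
apply/mxOverP => i z; rewrite ord1 -(tagnat.sig2K i).
have := xZ (vec_lift (enum_val (tagnat.sig1 i))) (tagnat.sig2 i).
by rewrite -spread_y period_mx_spread vec_liftK enum_valK mxE.
Qed.

End FixedPoints.

End Periodization.

(** * Ultrametric estimates and dominant coefficients *)

Section AbsoluteValue.
Variables (p : nat) (R : realType) (K : closedFieldType) (av : K -> R).
Hypotheses (p_prime : prime p) (avP : is_Cp p av).

Let av0 : av 0 = 0. Proof. exact/(av_eq0 avP). Qed.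

Lemma av_gt0 x : (0 < av x) = (x != 0).
Proof.
rewrite lt_def (av_ge0 avP) andbT; congr (~~ _).
by apply/eqP/eqP => /(av_eq0 avP).
Qed.

Lemma av1 : av 1 = 1.
Proof. by rewrite -(av_coprime avP (coprime1n p)). Qed.

Lemma avX x n : av (x ^+ n) = av x ^+ n.
Proof. by elim: n => [|n IHn]; rewrite ?av1 // !exprS (av_mul avP) IHn. Qed.

Lemma avV x : av x^-1 = (av x)^-1.
Proof.
have [->|x0] := eqVneq x 0; first by rewrite invr0 av0 invr0.
have avx0 : av x != 0 by rewrite gt_eqF // av_gt0.
by apply: (mulfI avx0); rewrite -(av_mul avP) !divff ?av1.
Qed.

Lemma avXz x (m : int) : av (x ^ m) = av x ^ m.
Proof. by case: m => n; rewrite ?avX // !NegzE -!exprz_inv -!exprnP avX avV. Qed.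

Lemma avN x : av (- x) = av x.
Proof.
rewrite -mulN1r (av_mul avP).
suff -> : av (-1) = 1 by rewrite mul1r.
by apply/eqP; rewrite -(@eqrXn2 _ 2) ?ler01 ?(av_ge0 avP) // -avX sqrrN !expr1n av1.
Qed.

Lemma avB x y : av (x - y) = av (y - x).
Proof. by rewrite -avN opprB. Qed.

(** If av (x + y) were smaller than av x, then x = (x + y) - y would be a sum of two smaller
    terms. *)
Lemma av_addl x y : av y < av x -> av (x + y) = av x.
Proof.
move=> yx; apply/eqP; rewrite eq_le; apply/andP; split.
  by rewrite (le_trans (av_ultra avP x y)) // ge_max lexx ltW.
have := av_ultra avP (x + y) (- y).
by rewrite addrK avN le_max leNgt [_ <= av y]leNgt yx orbF -leNgt.
Qed.

Lemma av_add_lt e x y : av x < e -> av y < e -> av (x + y) < e.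
Proof. by move=> xe ye; rewrite (le_lt_trans (av_ultra avP x y)) // gt_max xe. Qed.

Lemma av_add_le e x y : av x <= e -> av y <= e -> av (x + y) <= e.
Proof. by move=> xe ye; rewrite (le_trans (av_ultra avP x y)) // ge_max xe. Qed.

Lemma av_sub_lt e x y z : av (x - y) < e -> av (y - z) < e -> av (x - z) < e.
Proof. by move=> xy yz; rewrite -(subrKA y) av_add_lt. Qed.

Lemma av_sum_le (I : eqType) (s : seq I) (P : pred I) (F : I -> K) e : 0 <= e ->
  (forall i, i \in s -> P i -> av (F i) <= e) -> av (\sum_(i <- s | P i) F i) <= e.
Proof.
move=> e0 Fe; rewrite big_seq_cond; apply: (big_ind (fun x => av x <= e)).
- by rewrite av0.
- by move=> x y; apply: av_add_le.
- by move=> i /andP[]; apply: Fe.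
Qed.

Lemma av_prod (I : Type) (s : seq I) (P : pred I) (F : I -> K) :
  av (\prod_(i <- s | P i) F i) = \prod_(i <- s | P i) av (F i).
Proof. exact: (big_morph av (av_mul avP) av1). Qed.

(** Writing n = m p^k with m prime to p gives |n| = p^-k >= 1/n. This controls the denominators of
    the logarithm series. *)
Lemma av_nat_gt0 n : (0 < n)%N -> n%:R^-1 <= av n%:R.
Proof.
move=> n0; have [m cpm ->] := pfactor_coprime p_prime n0.
have m0 : (0 < m)%N by case: m cpm (p_prime) => //; rewrite /coprime gcdn0 => /eqP ->.
rewrite !natrM (av_mul avP) (av_coprime avP) 1?coprime_sym // mul1r !natrX avX (av_p avP).
rewrite invfM exprVn ler_piMl ?invr_ge0 ?exprn_ge0 //.
by rewrite invf_le1 ?ltr0n // ler1n.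
Qed.

Lemma natr_neq0 n : (0 < n)%N -> n%:R != 0 :> K.
Proof.
move=> n0; rewrite -av_gt0; apply: lt_le_trans (av_nat_gt0 n0).
by rewrite invr_gt0 ltr0n.
Qed.

Lemma av_root_of_unity n x : (0 < n)%N -> x ^+ n = 1 -> av x = 1.
Proof.
move=> n0 xn; apply/eqP; rewrite -(@eqrXn2 _ n) ?(av_ge0 avP) ?ler01 //.
by rewrite -avX xn expr1n av1.
Qed.

Lemma avX_cop N d : coprime N p -> av ((N ^ d)%:R)^-1 = 1.
Proof. by move=> Np; rewrite avV natrX avX (av_coprime avP) // expr1n invr1. Qed.

(** In terms of the Newton polygon: the polynomial is nonzero and no segment has slope 0. *)
Definition dominant_coef (P : {poly K}) (i : nat) :=
  forall j, j != i -> av P`_j < av P`_i.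

(** If |z| < 1 the factor X wins and the dominant index moves to i + 1; if |z| > 1 the constant -z
    wins and the index stays i. *)
Lemma dominant_coef_mulXsubC (Q : {poly K}) z i :
  av z != 1 -> dominant_coef Q i -> exists k, dominant_coef (Q * ('X - z%:P)) k.
Proof.
move=> z1 ltQ.
have coefE j : (Q * ('X - z%:P))`_j = (if j is j'.+1 then Q`_j' else 0) - Q`_j * z.
  by rewrite mulrBr coefB coefMX coefMC; case: j.
have Pi0 : 0 < av Q`_i by apply: le_lt_trans (ltQ i.+1 _); rewrite ?(av_ge0 avP) ?gtn_eqF.
have leQ j : av Q`_j <= av Q`_i by have [->//|/ltQ/ltW] := eqVneq j i.
have [z_lt1|z_gt1] := ltP (av z) 1; last first.
  have {z1}z_gt1 : 1 < av z by rewrite lt_def z1.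
  have avz : av (Q`_i * z) = av Q`_i * av z by rewrite (av_mul avP).
  have big_i : av Q`_i < av (Q`_i * z) by rewrite avz ltr_pMr.
  have shift j : av (if j is j'.+1 then Q`_j' else 0) < av (Q`_i * z).
    case: j => [|j]; last exact: le_lt_trans (leQ j) big_i.
    by rewrite av0 (lt_trans Pi0).
  exists i => j ji; rewrite !coefE [X in _ < X]avB.
  rewrite [X in _ < X]av_addl ?avN //; apply: av_add_lt; first exact: shift.
  by rewrite avN avz (av_mul avP) ltr_pM2r ?ltQ // (lt_trans ltr01).
have small j : av (Q`_j * z) < av Q`_i.
  rewrite (av_mul avP); apply: le_lt_trans (ler_wpM2r _ (leQ j)) _.
    exact: av_ge0 avP _.
  by rewrite gtr_pMr.
exists i.+1 => j ji; rewrite !coefE [X in _ < X]av_addl ?avN //.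
apply: av_add_lt; last by rewrite avN.
by case: j ji => [|j] ji; rewrite ?av0 // ltQ.
Qed.

Lemma ex_dominant_coef (P : {poly K}) :
  P != 0 -> (forall s, av s = 1 -> ~~ root P s) -> exists i, dominant_coef P i.
Proof.
move=> P0 rootP; have [s defP] := closed_field_poly_normal P.
have s1 : all (fun z => av z != 1) s.
  apply/allP => z zs; apply/negP => /eqP /rootP /negP; apply.
  by rewrite defP rootZ ?lead_coef_eq0 // root_prod_XsubC.
have c0 : lead_coef P != 0 by rewrite lead_coef_eq0.
move: (lead_coef P) c0 defP => c c0 ->.
elim: s s1 => [_|z s IHs /= /andP[z1 /IHs[i ltQ]]].
  exists 0%N => j j0; rewrite big_nil !coefZ !coef1 (negPf j0) mulr0 mulr1 av0.
  by rewrite av_gt0.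
by have := dominant_coef_mulXsubC z1 ltQ; rewrite big_cons [_ * \prod_(_ <- _) _]mulrC scalerAl.
Qed.

End AbsoluteValue.

(** * Laurent polynomial functions *)

Section LaurentPolynomials.
Variables (K : fieldType) (d : nat).
Implicit Types (z : 'I_d -> K) (nu : 'rV[int]_d) (F G : ('I_d -> K) -> K).

Definition lmonom z nu : K := \prod_(i < d) z i ^ nu ord0 i.

(** The list may repeat exponents, so that expansions of sums and products are obtained without
    merging terms. *)
Definition is_laurent F := exists s : seq (K * 'rV[int]_d),
  forall z, (forall i, z i != 0) -> F z = \sum_(x <- s) x.1 * lmonom z x.2.

Lemma lmonomD z nu mu : (forall i, z i != 0) ->
  lmonom z (nu + mu) = lmonom z nu * lmonom z mu.
Proof.
by move=> z0; rewrite -big_split; apply: eq_bigr => i _; rewrite mxE expfzDr.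
Qed.

Lemma lmonom0 z : lmonom z 0 = 1.
Proof. by rewrite /lmonom big1 // => i _; rewrite mxE expr0z. Qed.

Lemma lmonom_neq0 z nu : (forall i, z i != 0) -> lmonom z nu != 0.
Proof. by move=> z0; apply/prodf_neq0 => i _; rewrite expfz_neq0. Qed.

Lemma laurent_monom c nu : is_laurent (fun z => c * lmonom z nu).
Proof. by exists [:: (c, nu)] => z _; rewrite big_seq1. Qed.

Lemma laurent_const c : is_laurent (fun=> c).
Proof. by exists [:: (c, 0)] => z _; rewrite big_seq1 lmonom0 mulr1. Qed.

Lemma laurentD F G : is_laurent F -> is_laurent G -> is_laurent (fun z => F z + G z).
Proof. by move=> [s Fs] [t Gt]; exists (s ++ t) => z z0; rewrite big_cat Fs ?Gt. Qed.

Lemma laurentM F G : is_laurent F -> is_laurent G -> is_laurent (fun z => F z * G z).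
Proof.
move=> [s Fs] [t Gt]; exists [seq (x.1 * y.1, x.2 + y.2) | x <- s, y <- t] => z z0.
rewrite Fs // Gt // big_distrlr /= big_allpairs_dep /=.
by do 2![apply: eq_bigr => ? _]; rewrite lmonomD // mulrACA.
Qed.

Lemma laurent_sum (I : Type) (s : seq I) (P : pred I) (F : I -> ('I_d -> K) -> K) :
  (forall i, is_laurent (F i)) -> is_laurent (fun z => \sum_(i <- s | P i) F i z).
Proof.
move=> LF; elim: s => [|i s [t IHs]].
  by exists [::] => z z0; rewrite !big_nil.
have [u Fu] := LF i; exists (if P i then u ++ t else t) => z z0.
by rewrite big_cons IHs //; case: ifP => // _; rewrite big_cat Fu.
Qed.

Lemma laurent_prod (I : Type) (s : seq I) (P : pred I) (F : I -> ('I_d -> K) -> K) :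
  (forall i, is_laurent (F i)) -> is_laurent (fun z => \prod_(i <- s | P i) F i z).
Proof.
move=> LF; elim: s => [|i s [t IHs]].
  by exists [:: (1, 0)] => z z0; rewrite big_nil big_seq1 lmonom0 mulr1.
have [u Fu] : is_laurent (fun z => (if P i then F i z else 1) * \prod_(i <- s | P i) F i z).
  by apply: laurentM; [case: (P i) => //; apply: laurent_const | exists t].
by exists u => z z0; rewrite -Fu // big_cons; case: (P i); rewrite ?mul1r.
Qed.

Lemma laurentX F n : is_laurent F -> is_laurent (fun z => F z ^+ n).
Proof.
move=> LF; have [s Fs] := @laurent_prod _ (index_enum 'I_n) predT (fun=> F) (fun=> LF).
by exists s => z z0; rewrite -Fs // prodr_const card_ord.
Qed.

Lemma laurent_det r (a : 'rV[int]_d -> 'M[int]_r) (S : seq 'rV[int]_d) :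
  is_laurent (fun z => \det (lpoly_eval a S z)).
Proof.
apply: laurent_sum => s; apply: laurentM; first exact: laurent_const.
apply: laurent_prod => i.
have [t Ft] : is_laurent (fun z => \sum_(nu <- undup S) (a nu i (s i))%:~R * lmonom z nu).
  by apply: laurent_sum => nu; apply: laurent_monom.
exists t => z z0; rewrite -Ft // summxE; apply: eq_bigr => nu _.
by rewrite !mxE mulrC.
Qed.

(** Merging equal exponents gives the distinct exponents needed to compare coefficients. *)
Lemma laurent_collect F : is_laurent F -> exists (S : seq 'rV[int]_d) (c : 'rV[int]_d -> K),
  uniq S /\ forall z, (forall i, z i != 0) -> F z = \sum_(nu <- S) c nu * lmonom z nu.
Proof.
move=> [s Fs]; exists (undup (map snd s)), (fun nu => \sum_(x <- s | x.2 == nu) x.1).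
split=> [|z z0]; first exact: undup_uniq.
rewrite Fs //; under [RHS]eq_bigr do rewrite big_distrl /= big_mkcond /=.
rewrite exchange_big /= big_seq [RHS]big_seq; apply: eq_bigr => x xs.
rewrite (bigD1_seq x.2) ?undup_uniq //=; last by rewrite mem_undup map_f.
by rewrite eqxx big1 ?addr0 // => nu; rewrite eq_sym => /negPf ->.
Qed.

(* [B] is chosen outside the finitely many roots of the polynomials whose coefficient
   vectors are the differences of distinct elements of [S]. *)
Lemma kronecker_injective (S : seq 'rV[int]_d) :
  exists B : nat, {in S &, injective (fun nu => \sum_(i < d) nu ord0 i * (B ^ i)%:Z)}.
Proof.
pose D := [seq x <- [seq u - v | u <- S, v <- S] | x != 0].
pose q := \prod_(x <- D) rVpoly x.
have q0 : q != 0.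
  rewrite prodf_seq_neq0; apply/allP => x; rewrite mem_filter => /andP[x0 _] /=.
  by apply: contraNneq x0 => /(congr1 (@poly_rV _ d)); rewrite rVpolyK linear0 => ->.
(* A nonzero polynomial has fewer than [size q] roots, so one of the integers 0, ..., [size q] - 1
   is not a root. *)
have [B rootB] : exists B : nat, ~~ root q B%:R.
  pose rs : seq int := [seq n%:R | n <- iota 0 (size q)].
  have uniq_rs : uniq rs by rewrite map_inj_uniq ?iota_uniq // => m n /eqP; rewrite eqr_nat => /eqP.
  have : ~~ all (root q) rs.
    by apply/negP => /(max_poly_roots q0)/(_ uniq_rs); rewrite size_map size_iota ltnn.
  by case/allPn => _ /mapP[n _ ->] ?; exists n.
exists B => u v uS vS /eqP; rewrite -subr_eq0 -sumrB => /eqP sum0.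
apply/eqP; rewrite -subr_eq0; apply: contraNT rootB => uv0.
have uvD : u - v \in D by rewrite mem_filter uv0; apply/allpairsP; exists (u, v).
rewrite /root /q horner_prod prodf_seq_eq0; apply/hasP; exists (u - v) => //=.
rewrite /rVpoly horner_poly -[X in _ == X]sum0; apply/eqP/eq_bigr => i _.
rewrite insubT //= => ?; rewrite !mxE mulrBl -[Posz (B ^ i)]natz natrX.
by congr (u _ _ * _ - v _ _ * _); apply: val_inj.
Qed.

End LaurentPolynomials.

(** * Laurent polynomials without zeros on the unit torus *)

Section LaurentUnits.
Variables (p : nat) (R : realType) (K : closedFieldType) (av : K -> R) (d : nat).
Hypotheses (p_prime : prime p) (avP : is_Cp p av).
Implicit Types (z : 'I_d -> K) (nu : 'rV[int]_d) (F : ('I_d -> K) -> K).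

Definition unit_torus z := forall i, av (z i) = 1.

Lemma unit_torus_neq0 z : unit_torus z -> forall i, z i != 0.
Proof. by move=> z1 i; rewrite -(av_gt0 avP) z1. Qed.

Lemma av_lmonom z nu : unit_torus z -> av (lmonom z nu) = 1.
Proof.
by move=> z1; rewrite (av_prod avP) big1 // => i _; rewrite (avXz avP) z1 exp1rz.
Qed.

(** A root s of the one-variable polynomial with |s| = 1 would produce the zero (s^(B^i))_i of the
    sum on the torus; hence that polynomial has a dominant coefficient. *)
Lemma laurent_dominant (S : seq 'rV[int]_d) (c : 'rV[int]_d -> K) : uniq S ->
  (forall z, unit_torus z -> \sum_(nu <- S) c nu * lmonom z nu != 0) ->
  exists2 nu0, nu0 \in S & forall nu, nu \in S -> nu != nu0 -> av (c nu) < av (c nu0).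
Proof.
move=> uniqS F0; have [B injB] := kronecker_injective S.
pose e nu : int := \sum_(i < d) nu ord0 i * (B ^ i)%:Z.
(* [M] is at least every |e nu|, so multiplying by s^M removes the negative exponents. *)
pose M := (\sum_(nu <- S) absz (e nu))%N.
pose k nu := absz (e nu + M%:Z).
have kE nu : nu \in S -> (k nu)%:Z = e nu + M%:Z.
  move=> nuS; rewrite /k gez0_abs //.
  have : (absz (e nu) <= M)%N by rewrite /M (big_rem nu) //= leq_addr.
  by case: (e nu) => n //; rewrite NegzE abszN /= => ?; rewrite addrC subr_ge0 lez_nat.
have injk : {in S &, injective k}.
  move=> u v uS vS /(congr1 Posz); rewrite !kE // => /addIr; exact: injB.
pose P : {poly K} := \sum_(nu <- S) c nu *: 'X^(k nu).
have coefP nu : nu \in S -> P`_(k nu) = c nu.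
  move=> nuS; rewrite coef_sum (bigD1_seq nu) //= coefZ coefXn eqxx mulr1.
  rewrite big_seq_cond big1 ?addr0 // => mu /andP[muS munu].
  rewrite coefZ coefXn; case: eqP => [/injk eq_mu|_]; last by rewrite mulr0.
  by rewrite eq_mu ?eqxx in munu.
have rootP s : av s = 1 -> ~~ root P s.
  move=> s1; have s0 : s != 0 by rewrite -(av_gt0 avP) s1.
  have zT : unit_torus (fun i : 'I_d => s ^+ (B ^ i)) by move=> i; rewrite (avX avP) s1 expr1n.
  suff -> : root P s =
      (s ^+ M * \sum_(nu <- S) c nu * lmonom (fun i : 'I_d => s ^+ (B ^ i)) nu == 0).
    by rewrite mulf_neq0 ?expf_neq0 ?F0.
  rewrite /root horner_sum mulr_sumr; congr (_ == 0).
  rewrite big_seq [RHS]big_seq; apply: eq_bigr => nu nuS.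
  rewrite hornerZ hornerXn mulrCA; congr (_ * _).
  rewrite [s ^+ k nu]exprnP kE // addrC expfzDr //; congr (_ * _).
  rewrite /e /lmonom; elim/big_rec2: _ => [|i x y _ IH]; first exact: expr0z.
  by rewrite expfzDr // IH mulrC exprnP exprz_exp mulrC [nu _ _ * _]mulrC.
have P0 : P != 0 by apply: contraTneq (rootP _ (av1 avP)) => ->; rewrite root0.
have [i ltP] := ex_dominant_coef avP P0 rootP.
have Pi0 : P`_i != 0.
  by rewrite -(av_gt0 avP); apply: le_lt_trans (ltP i.+1 _); rewrite ?(av_ge0 avP) ?gtn_eqF.
have /hasP[nu0 nu0S /eqP ki] : has (fun nu => k nu == i) S.
  apply: contraNT Pi0 => /hasPn nok; rewrite coef_sum big_seq big1 // => nu /nok ki.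
  by rewrite coefZ coefXn eq_sym (negPf ki) mulr0.
exists nu0 => // nu nuS nu_nu0; rewrite -!coefP // ki; apply: ltP.
by rewrite -ki; apply: contraNneq nu_nu0 => /injk ->.
Qed.

(* A Laurent polynomial without zeros on the torus is a unit [c t^nu0 (1 + h)] of the
   Tate algebra, with [h] of Gauss norm less than 1. *)
Lemma laurent_unit F : is_laurent F -> (forall z, unit_torus z -> F z != 0) ->
  exists (c : K) (nu0 : 'rV[int]_d) (h : ('I_d -> K) -> K) (rho : R),
    [/\ c != 0, is_laurent h, 0 <= rho < 1, forall z, unit_torus z -> av (h z) <= rho &
        forall z, unit_torus z -> F z = c * lmonom z nu0 * (1 + h z)].
Proof.
move=> LF F0; have [S [c [uniqS FE]]] := laurent_collect LF.
have FT z : unit_torus z -> F z = \sum_(nu <- S) c nu * lmonom z nu.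
  by move=> /unit_torus_neq0; apply: FE.
have [|nu0 nu0S lt_c] := @laurent_dominant S c uniqS.
  by move=> z zT; rewrite -FT ?F0.
(* Were [c nu0] zero, the strict inequalities would leave no other exponent in S, and F would vanish
   at (1, ..., 1). *)
have c0 : c nu0 != 0.
  apply: contraTneq (F0 (fun=> 1) (fun=> av1 avP)) => c0.
  rewrite FT; last by move=> i; exact: av1 avP.
  rewrite big_seq big1 ?eqxx // => nu nuS; have [->|/(lt_c nu nuS)] := eqVneq nu nu0.
    by rewrite c0 mul0r.
  by rewrite c0 (av_eq0 avP 0).2 // ltNge (av_ge0 avP).
(* [rho] is the maximum of 0 and finitely many ratios below 1; the exponent nu0, whose ratio is 1,
   is skipped. *)
have [rho rho01 le_rho] : exists2 rho : R, 0 <= rho < 1 &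
    forall nu, nu \in S -> nu != nu0 -> av (c nu / c nu0) <= rho.
  have lt1 nu : nu \in S -> nu != nu0 -> av (c nu / c nu0) < 1.
    move=> nuS ne; rewrite (av_mul avP) (avV avP) ltr_pdivrMr ?(av_gt0 avP) //.
    by rewrite mul1r lt_c.
  elim: (S) lt1 => [_|mu s IHs lt1]; first by exists 0; rewrite ?lexx ?ltr01.
  have [|rho /andP[rho0 rho1] le_rho] := IHs.
    by move=> nu nus; apply: lt1; rewrite inE nus orbT.
  exists (if mu == nu0 then rho else Num.max rho (av (c mu / c nu0))).
    case: eqVneq => mu0; first by rewrite rho0.
    by rewrite le_max rho0 gt_max rho1 lt1 // mem_head.
  move=> nu; rewrite inE => /orP[/eqP -> /negPf ->|nus ne].
    by rewrite le_max lexx orbT.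
  by case: ifP => _; rewrite ?le_max le_rho.
exists (c nu0), nu0, (fun z => \sum_(nu <- S | nu != nu0) c nu / c nu0 * lmonom z (nu - nu0)), rho.
split=> // [|z zT|z zT].
- by apply: laurent_sum => nu; apply: laurent_monom.
- apply: (av_sum_le avP); first by case/andP: rho01.
  by move=> nu nuS ne; rewrite (av_mul avP) av_lmonom // mulr1 le_rho.
- rewrite FT // (bigD1_seq nu0) //= mulrDr mulr1 mulr_sumr; congr (_ + _).
  apply: eq_bigr => nu _; rewrite mulrACA [c nu0 * _]mulrCA divff // mulr1.
  by rewrite -lmonomD ?subrKC //; exact: unit_torus_neq0.
Qed.

End LaurentUnits.

(** * Snirelman averages and the integral of the logarithm *)

Section SnirelmanIntegral.

Lemma sum_root_of_unity (F : fieldType) n (w : F) :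
  w ^+ n = 1 -> \sum_(i < n) w ^+ i = if w == 1 then n%:R else 0.
Proof.
move=> wn; case: eqVneq => [->|w1].
  by under eq_bigr do rewrite expr1n; rewrite sumr_const card_ord.
have := subrX1 w n; rewrite wn subrr => /esym/eqP.
by rewrite mulf_eq0 subr_eq0 (negPf w1) => /eqP.
Qed.

Lemma prim_root_exprz_eq1 (F : fieldType) n (w : F) (m : int) :
  n.-primitive_root w -> (w ^ m == 1) = (n %| m)%Z.
Proof.
move=> prim_w; case: m => m; first by rewrite -exprnP -(prim_order_dvd prim_w).
rewrite NegzE -exprz_inv -exprnP exprVn invr_eq1 -(prim_order_dvd prim_w).
by rewrite dvdzE abszN.
Qed.

Variables (p : nat) (R : realType) (K : closedFieldType) (av : K -> R) (d : nat).
Variables (xi : nat -> K).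
Hypotheses (p_prime : prime p) (avP : is_Cp p av).
Hypothesis xiP : forall N, (0 < N)%N -> coprime N p -> N.-primitive_root (xi N).
Implicit Types (F : ('I_d -> K) -> K).

Definition root_point N (k : {ffun 'I_d -> 'I_N}) : 'I_d -> K := fun i => xi N ^+ k i.

Definition root_average N F : K :=
  ((N ^ d)%:R)^-1 * \sum_(k : {ffun 'I_d -> 'I_N}) F (root_point k).

Lemma root_pointX N (k : {ffun 'I_d -> 'I_N}) i :
  (0 < N)%N -> coprime N p -> root_point k i ^+ N = 1.
Proof. by move=> N0 Np; rewrite exprAC (prim_expr_order (xiP N0 Np)) expr1n. Qed.

Lemma root_point_torus N (k : {ffun 'I_d -> 'I_N}) :
  (0 < N)%N -> coprime N p -> unit_torus av (root_point k).
Proof. by move=> N0 Np i; apply: (av_root_of_unity avP N0); apply: root_pointX. Qed.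

(** Orthogonality: the sum is a product of d geometric sums, one per coordinate. *)
Lemma sum_lmonom N nu : (0 < N)%N -> coprime N p ->
  \sum_(k : {ffun 'I_d -> 'I_N}) lmonom (root_point k) nu =
  if [forall i, (N %| nu ord0 i)%Z] then (N ^ d)%:R else 0.
Proof.
move=> N0 Np; have prim := xiP N0 Np.
transitivity (\prod_(i < d) \sum_(j < N) (xi N ^ nu ord0 i) ^+ j).
  rewrite bigA_distr_bigA; apply: eq_bigr => k _; apply: eq_bigr => i _.
  by rewrite /root_point !exprnP !exprz_exp mulrC.
transitivity (\prod_(i < d) if (N %| nu ord0 i)%Z then N%:R else 0 : K).
  apply: eq_bigr => i _; rewrite sum_root_of_unity ?(prim_root_exprz_eq1 _ prim) //.
  by rewrite exprnP exprz_exp mulrC -exprz_exp -exprnP (prim_expr_order prim) exp1rz.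
case: forallP => [dvd|/forallP].
  by under eq_bigr do rewrite dvd; rewrite prodr_const card_ord natrX.
by rewrite negb_forall => /existsP[i /negPf ndvd]; rewrite (bigD1 i) //= ndvd mul0r.
Qed.

(** An exponent contributes only if N divides all its coordinates; once N exceeds their absolute
    values, only the constant term survives. *)
Lemma root_average_stable F : is_laurent F ->
  exists C M, forall N, (M <= N)%N -> coprime N p -> root_average N F = C.
Proof.
move=> [s Fs]; pose m := (\sum_(x <- s) \sum_(i < d) absz (x.2 ord0 i))%N.
exists (\sum_(x <- s) x.1 *+ (x.2 == 0)), m.+1 => N mN Np.
have N0 : (0 < N)%N by apply: leq_trans mN.
have FE (k : {ffun 'I_d -> 'I_N}) := Fs _ (unit_torus_neq0 avP (root_point_torus k N0 Np)).
rewrite /root_average; under eq_bigr do rewrite FE.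
rewrite exchange_big mulr_sumr /= big_seq [RHS]big_seq; apply: eq_bigr => x xs.
rewrite -mulr_sumr sum_lmonom //.
have -> : [forall i, (N %| x.2 ord0 i)%Z] = (x.2 == 0).
  apply/forallP/eqP => [dvd|-> i]; last by rewrite mxE dvdz0.
  apply/rowP => i; rewrite mxE; apply/eqP; rewrite -absz_eq0.
  have [/eqP//|nu_gt0] := posnP (absz (x.2 ord0 i)).
  have := dvdn_leq nu_gt0 (dvd i); rewrite leqNgt (leq_trans _ mN) // ltnS.
  by rewrite /m (big_rem x) //= (bigD1 i) //= -addnA leq_addr.
case: eqP => _; rewrite ?mulr0 // mulr1n mulrCA mulVf ?mulr1 //.
by apply: (natr_neq0 p_prime avP); rewrite expn_gt0 N0.
Qed.

(** Completeness speaks of sequences over all of [nat], so the limit is taken along N = j p + 1,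
    which is prime to p, and then carried to every N prime to p. *)
Lemma cop_subseq_cvg (u : nat -> K) :
  (forall eps : R, 0 < eps -> exists C M, forall N,
    (M <= N)%N -> coprime N p -> av (u N - C) < eps) ->
  exists l, av_cvg_cop p av u l.
Proof.
move=> uC; pose v j := u (j * p).+1.
have cop j : coprime (j * p).+1 p.
  by rewrite coprime_sym /coprime -addn1 gcdnMDl gcdn1.
have le_j j : (j <= (j * p).+1)%N by rewrite leqW // leq_pmulr // prime_gt0.
have [eps eps0|l vl] := av_complete avP (u := v).
  have [C [M uCM]] := uC _ eps0; exists M => m n Mm Mn.
  apply: (@av_sub_lt _ _ _ _ avP _ _ C); last rewrite (avB avP).
    by apply: uCM => //; apply: leq_trans Mm _.
  by apply: uCM => //; apply: leq_trans Mn _.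
exists l => eps eps0; have [C [M uCM]] := uC _ eps0; have [J vJ] := vl _ eps0.
exists M => n Mn np; apply: (@av_sub_lt _ _ _ _ avP _ _ C); first exact: uCM.
apply: (@av_sub_lt _ _ _ _ avP _ _ (v (maxn M J))); last by apply: vJ; rewrite leq_maxr.
by rewrite (avB avP); apply: uCM => //; apply: leq_trans (le_j _); rewrite leq_maxl.
Qed.

(** With rho^-1 = 1 + D and rho > 0, the second-order binomial bound gives rho^(n+1) (n+1) <= 2 /
    (D^2 n). *)
Lemma expr_natmul_small (rho eps : R) : 0 <= rho < 1 -> 0 < eps ->
  exists M, forall n, (M <= n)%N -> rho ^+ n.+1 * n.+1%:R <= eps.
Proof.
move=> /andP[rho0 rho1] eps0; have [->|rho_neq0] := eqVneq rho 0.
  by exists 0%N => n _; rewrite exprS !mul0r ltW.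
have {rho_neq0}rho0 : 0 < rho by rewrite lt_def rho_neq0.
pose D := rho^-1 - 1; have D0 : 0 < D by rewrite subr_gt0 invf_gt1.
have binom2 n : D ^+ 2 * (n.+1%:R * n%:R) <= 2 * rho^-1 ^+ n.+1.
  have -> : rho^-1 = D + 1 by rewrite /D subrK.
  elim: n => [|n IHn]; first by rewrite mulr0 !mulr0 mulr_ge0 // exprn_ge0 // addr_ge0 ?ltW.
  have bern : 1 + n.+1%:R * D <= (D + 1) ^+ n.+1.
    elim: (n.+1) => [|k IHk]; first by rewrite mul0r addr0.
    have kD : 0 <= k%:R * D * D by rewrite !mulr_ge0 ?ler0n ?ltW.
    rewrite exprS; apply: le_trans (ler_wpM2l _ IHk); last by rewrite addr_ge0 ?ltW.
    by rewrite -natr1; nra.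
  rewrite [(D + 1) ^+ n.+2]exprS; have := ler_wpM2l (ltW D0) bern; move: IHn.
  rewrite -[n.+2%:R]natr1 -[n.+1%:R]natr1; set X := (D + 1) ^+ n.+1; set m := n%:R.
  by move=> IHn DX; lra.
have [M] : exists M : nat, 2 / (D ^+ 2 * eps) < M%:R.
  by exists (Num.bound (2 / (D ^+ 2 * eps))); apply: archi_boundP;
     rewrite divr_ge0 ?mulr_ge0 ?exprn_ge0 ?ltW.
rewrite ltr_pdivrMr ?mulr_gt0 ?exprn_gt0 // => ltM.
exists M.+1 => n Mn; have n0 : 0 < n%:R :> R by rewrite ltr0n (leq_trans _ Mn).
have {ltM}ltn : 2 <= n%:R * (D ^+ 2 * eps).
  by rewrite (le_trans (ltW ltM)) // ler_wpM2r ?mulr_ge0 ?exprn_ge0 ?ler_nat ?ltW // ltnW.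
have rn0 : 0 < rho ^+ n.+1 by rewrite exprn_gt0.
have := binom2 n; rewrite exprVn ler_pdivlMr // => le2.
rewrite -(ler_pM2r (mulr_gt0 n0 (exprn_gt0 2 D0))) mulrC.
apply: le_trans (_ : 2 <= _); last by rewrite (le_trans ltn) // mulrA [_ * eps]mulrC.
by apply: le_trans le2; rewrite le_eqVlt; apply/orP; left; apply/eqP; ring.
Qed.

Variable lg : K -> K.
Hypothesis lgP : is_plog p av lg.

Lemma lgM x y : x != 0 -> y != 0 -> lg (x * y) = lg x + lg y.
Proof. by case: lgP => + _ _; apply. Qed.

Lemma lg1 : lg 1 = 0.
Proof. by apply: (addIr (lg 1)); rewrite add0r -lgM ?oner_neq0 // mulr1. Qed.

Lemma lgX x n : x != 0 -> lg (x ^+ n) = lg x *+ n.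
Proof.
by move=> x0; elim: n => [|n IHn]; rewrite ?lg1 // exprS lgM ?expf_neq0 // IHn mulrS.
Qed.

Lemma lg_root_of_unity x n : (0 < n)%N -> x ^+ n = 1 -> lg x = 0.
Proof.
move=> n0 xn; have x0 : x != 0 by rewrite -(av_gt0 avP) (av_root_of_unity avP n0 xn).
have /eqP := lgX n x0; rewrite xn lg1 eq_sym -mulr_natr mulf_eq0.
by rewrite (negPf (natr_neq0 p_prime avP n0)) orbF => /eqP.
Qed.

Lemma lg_prod (I : finType) (F : I -> K) :
  (forall i, F i != 0) -> lg (\prod_i F i) = \sum_i lg (F i).
Proof.
move=> F0; suff [] : lg (\prod_i F i) = \sum_i lg (F i) /\ \prod_i F i != 0 by [].
elim/big_rec2: _ => [|i x y _ [IH y0]]; first by rewrite lg1 oner_neq0.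
by rewrite lgM // IH mulf_neq0.
Qed.

(** lg (-1) = 0 because -1 is a root of unity, so the sign lost in counting points does not
    matter. *)
Lemma lg_absz (m : int) : lg (absz m)%:R = lg m%:~R.
Proof.
case: m => m //; rewrite NegzE abszN mulrNz -mulN1r lgM ?oppr_eq0 ?oner_neq0 //.
  by rewrite (@lg_root_of_unity (-1) 2) ?sqrrN ?expr1n ?add0r.
exact: (natr_neq0 p_prime avP).
Qed.

Definition log_trunc M (x : K) := \sum_(n < M) (-1) ^+ n * x ^+ n.+1 / n.+1%:R.

(** [M] is uniform in x: since |n + 1| >= 1 / (n + 1), the terms of the tail are at most rho^(n+1)
    (n+1), and an ultrametric sum never exceeds its largest term. *)
Lemma lg_log_trunc (rho eps : R) : 0 <= rho < 1 -> 0 < eps ->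
  exists M, forall x, av x <= rho -> av (lg (1 + x) - log_trunc M x) <= eps.
Proof.
move=> rho01 eps0; have [M Mtail] := expr_natmul_small rho01 eps0.
exists M => x x_rho; have [_ _ series] := lgP.
have xE : 1 + x - 1 = x by rewrite addrC addKr.
have x1 : av (1 + x - 1) < 1 by rewrite xE (le_lt_trans x_rho) //; case/andP: rho01.
(* [J] depends on x, but it only serves to compare lg with a partial sum at least as long as [M]. *)
have [J closeJ] := series _ x1 _ eps0.
have := closeJ (maxn M J) (leq_maxr _ _); rewrite xE (avB avP) => close.
rewrite -(subrKA (log_trunc (maxn M J) x)); apply: (av_add_le avP); first exact: ltW.
rewrite /log_trunc -!(big_mkord xpredT (fun n => (-1) ^+ n * x ^+ n.+1 / n.+1%:R)).
rewrite (big_cat_nat (leq0n M) (leq_maxl M J)) /= addrAC subrr add0r.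
apply: (av_sum_le avP); first exact: ltW.
move=> n; rewrite mem_index_iota => /andP[Mn _] _.
rewrite !(av_mul avP) !(avX avP) (avN avP) (av1 avP) expr1n mul1r (avV avP).
apply: le_trans (Mtail n Mn); apply: ler_pM; rewrite ?invr_ge0 ?exprn_ge0 ?(av_ge0 avP) //.
  by rewrite lerXn2r ?nnegrE ?(av_ge0 avP) //; case/andP: rho01.
by rewrite invf_ple ?posrE ?ltr0n ?(av_nat_gt0 p_prime avP) // (av_gt0 avP) (natr_neq0 p_prime avP).
Qed.

Lemma laurent_log_trunc M F : is_laurent F -> is_laurent (fun z => log_trunc M (F z)).
Proof.
move=> LF; rewrite /log_trunc; apply: laurent_sum => n.
apply: laurentM; last exact: laurent_const.
by apply: laurentM; [apply: laurent_const | apply: laurentX].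
Qed.

(** At roots of unity lg F = lg c + lg (1 + h), as lg kills the monomial. Truncating the series
    costs at most eps / 2 at each point and leaves a Laurent polynomial, whose averages are
    eventually constant. *)
Lemma snirelman_log_cvg F : is_laurent F -> (forall z, unit_torus av z -> F z != 0) ->
  exists m, av_cvg_cop p av (fun N => root_average N (fun z => lg (F z))) m.
Proof.
move=> LF F0; have [c [nu0 [h [rho [c0 Lh rho01 h_rho FE]]]]] := laurent_unit avP LF F0.
apply: cop_subseq_cvg => eps eps0; have eps2 : 0 < eps / 2 by rewrite divr_gt0.
have [M logM] := lg_log_trunc rho01 eps2.
have Ltrunc : is_laurent (fun z => lg c + log_trunc M (h z)).
  by apply: laurentD; [apply: laurent_const | apply: laurent_log_trunc].
have [C [J avgC]] := root_average_stable Ltrunc.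
exists C, J.+1 => N JN Np; rewrite -(avgC N (ltnW JN) Np).
have N0 : (0 < N)%N by apply: leq_trans JN.
rewrite /root_average -mulrBr -sumrB; apply: (@le_lt_trans _ _ (eps / 2)).
  (* Dividing by N^d preserves absolute values, as N is prime to p. *)
  rewrite (av_mul avP) (avX_cop avP) // mul1r; apply: (av_sum_le avP); first exact: ltW.
  move=> k _ _; have zT := root_point_torus k N0 Np.
  have mon0 : lmonom (root_point k) nu0 != 0 by apply/lmonom_neq0/(unit_torus_neq0 avP).
  have := F0 _ zT; rewrite FE // mulf_eq0 negb_or => /andP[cmon h1].
  rewrite lgM // lgM // (@lg_root_of_unity (lmonom _ _) N) //; last first.
    rewrite /lmonom -prodrXl big1 // => i _.
    by rewrite exprnP exprz_exp mulrC -exprz_exp -exprnP root_pointX // exp1rz.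
  by rewrite addr0 opprD addrACA subrr add0r logM // h_rho.
by rewrite gtr_pMr // invf_lt1 ?ltr1n.
Qed.

End SnirelmanIntegral.

(** * Fourier transform of the period matrix *)

Lemma det_mxdiag (F : comPzRingType) m (s : 'I_m -> nat) (B : forall i, 'M[F]_(s i)) :
  \det (\mxdiag_i B i) = \prod_i \det (B i).
Proof.
elim: m s B => [|m IHm] s B.
  by rewrite [RHS]big_ord0; move: (\mxdiag__ _); rewrite big_ord0 => M; rewrite det_mx00.
rewrite mxdiag_recl [RHS]big_ord_recl /= -IHm.
by case: _ / mxsize_recl; rewrite castmx_id det_lblock.
Qed.

Section PeriodDeterminant.
Variables (p : nat) (R : realType) (K : closedFieldType) (av : K -> R) (d r n : nat).
Variables (a : 'rV[int]_d -> 'M[int]_r) (S : seq 'rV[int]_d) (xi : nat -> K).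
Hypotheses (p_prime : prime p) (avP : is_Cp p av) (n_cop : coprime n.+1 p).
Hypothesis xiP : forall N, (0 < N)%N -> coprime N p -> N.-primitive_root (xi N).
Local Notation T := {ffun 'I_d -> 'I_n.+1}.
Local Notation q := #|{: T}|.
Implicit Types k l : T.
Local Notation point := (root_point xi).

Let point_neq0 k i : point k i != 0.
Proof. exact: unit_torus_neq0 avP _ (root_point_torus avP xiP k (ltn0Sn n) n_cop) i. Qed.

(** At [n.+1]-th roots of unity a monomial is a character of the finite quotient group. *)
Lemma lmonom_point_red k mu :
  lmonom (point k) (vec_lift (vec_red n mu)) = lmonom (point k) mu.
Proof.
apply: eq_bigr => i _; rewrite mxE val_vec_red [in RHS](divz_eq (mu ord0 i) n.+1).
rewrite [RHS]expfzDr // [(_ %/ _)%Z * _]mulrC -exprz_exp -exprnP.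
by rewrite (root_pointX xiP) // exp1rz mul1r.
Qed.

(** The pairing of points and exponents is symmetric, so the summation index can serve as the point
    and [sum_lmonom] applies. *)
Lemma sum_char k l :
  \sum_(m : T) lmonom (point k) (- vec_lift m) * lmonom (point l) (vec_lift m) =
  if k == l then (n.+1 ^ d)%:R else 0.
Proof.
transitivity (\sum_(m : T) lmonom (point m) (vec_lift l - vec_lift k)).
  apply: eq_bigr => m _; rewrite addrC lmonomD //; congr (_ * _).
    by apply: eq_bigr => i _; rewrite !mxE /root_point !exprnP !exprz_exp !mulrN mulrC.
  by apply: eq_bigr => i _; rewrite !mxE /root_point !exprnP !exprz_exp mulrC.
rewrite (sum_lmonom xiP) //; congr (if _ then _ else _).
transitivity (congr_vec n (vec_lift l) (vec_lift k)); first by apply: eq_forallb => i; rewrite !mxE.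
by apply/congr_vecP/eqP; rewrite !vec_liftK => ->.
Qed.

(* The Fourier matrix conjugates [period_mx] to the block diagonal matrix of the
   values of [f] at the points of [mu_n^d]. *)
Lemma det_period_mx :
  (\det (period_mx n a S))%:~R = \prod_(k : T) \det (lpoly_eval a S (point k)) :> K.
Proof.
pose val_f k := lpoly_eval a S (point k).
pose W : 'M[K]_(\sum_(i < q) r) := \mxblock_(i < q, j < q)
  ((lmonom (point (enum_val j)) (vec_lift (enum_val i)))%:M : 'M[K]_r).
pose W' : 'M[K]_(\sum_(i < q) r) := \mxblock_(i < q, j < q)
  ((lmonom (point (enum_val i)) (- vec_lift (enum_val j)))%:M : 'M[K]_r).
(* Up to the factor (n+1)^d, [W'] is the inverse of [W]; this yields that det W is nonzero. *)
have W'W : W' *m W = ((n.+1 ^ d)%:R)%:M.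
  rewrite mul_mxblock -mxdiagZ; apply: eq_mxblock => i j.
  under eq_bigr do rewrite -scalar_mxM.
  rewrite -raddf_sum /= (reindex enum_rank) /=; last exact/onW_bij/enum_rank_bij.
  under eq_bigr do rewrite enum_rankK.
  rewrite sum_char (inj_eq enum_val_inj) conform_mx_id.
  by case: eqP => _; rewrite ?raddf0.
have detW : \det W != 0.
  have : \det W' * \det W != 0.
    by rewrite -det_mulmx W'W det_scalar expf_neq0 // (natr_neq0 p_prime avP) // expn_gt0.
  by rewrite mulf_eq0 negb_or => /andP[].
(* Characters diagonalize convolution: on column block j the period matrix acts as the value of f at
   the j-th point. *)
have AW : map_mx intr (period_mx n a S) *m W = W *m \mxdiag_(j < q) val_f (enum_val j).
  rewrite map_mx_period_mx mul_mxblock mul_mxblock_mxdiag; apply: eq_mxblock => i j.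
  rewrite (reindex enum_rank) /=; last exact/onW_bij/enum_rank_bij.
  under eq_bigr do rewrite enum_rankK mul_mx_scalar period_block_map scaler_sumr.
  rewrite (sum_period _ (fun nu k =>
    lmonom (point (enum_val j)) (vec_lift k) *: map_mx intr (a nu))).
  rewrite mul_scalar_mx scaler_sumr; apply: eq_bigr => nu _.
  by rewrite lmonom_point_red lmonomD // scalerA.
rewrite -det_map_mx; apply: (mulIf detW); rewrite -det_mulmx AW det_mulmx mulrC; congr (_ * _).
rewrite det_mxdiag (reindex enum_rank) /=; last exact/onW_bij/enum_rank_bij.
by under eq_bigr do rewrite enum_rankK.
Qed.

End PeriodDeterminant.

(** * Equality of the entropy and the Snirelman integral *)

Theorem theorem3p2 (p : nat) (R : realType) (K : closedFieldType)
  (av : K -> R) (lg : K -> K) (d r : nat)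
  (a : 'rV[int]_d -> 'M[int]_r) (S : seq 'rV[int]_d) (xi : nat -> K) :
  prime p -> is_Cp p av -> is_plog p av lg ->
  (forall nu, nu \notin S -> a nu = 0) ->
  (forall z : 'I_d -> K, (forall i, av (z i) = 1) -> lpoly_eval a S z \in unitmx) ->
  (forall N : nat, (0 < N)%N -> coprime N p -> N.-primitive_root (xi N)) ->
  exists (m : K) (c : nat -> nat),
    (* m = m_p(det f), the Snirelman integral of log_p(det f) over T_p^d *)
    av_cvg_cop p av
      (fun N => ((N ^ d)%:R)^-1 *
         \sum_(k : {ffun 'I_d -> 'I_N})
            lg (\det (lpoly_eval a S (fun i => xi N ^+ k i)))) m /\
    (* c n = |Fix_{Gamma_n}(X_f)| *)
    (forall n : nat, (0 < n)%N -> coprime n p -> @fixXf R d r a S n #= `I_(c n)) /\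
    (* h_p(f) = lim n^{-d} log_p |Fix_{Gamma_n}(X_f)| = m *)
    av_cvg_cop p av (fun n => ((n ^ d)%:R)^-1 * lg (c n)%:R) m.
Proof.
move=> p_prime avP lgP _ f_unit xiP.
have det0 z : unit_torus av z -> \det (lpoly_eval a S z) != 0.
  by move=> /f_unit; rewrite unitmxE unitfE.
have [m mP] := snirelman_log_cvg p_prime avP xiP lgP (laurent_det K a S) det0.
(* [period_mx n] belongs to the period n + 1, hence the predecessor. *)
pose c n := absz (\det (period_mx n.-1 a S)).
have detE n : coprime n.+1 p -> (\det (period_mx n a S))%:~R =
    \prod_(k : {ffun 'I_d -> 'I_n.+1}) \det (lpoly_eval a S (root_point xi k)) :> K.
  by move=> np; apply: det_period_mx p_prime avP np xiP.
have point_det0 n (k : {ffun 'I_d -> 'I_n.+1}) : coprime n.+1 p ->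
    \det (lpoly_eval a S (root_point xi k)) != 0.
  by move=> np; apply/det0/(root_point_torus avP xiP).
exists m, c; split=> //; split.
  case=> // n _ np; apply: card_fixXf; apply/eqP => det_eq0.
  have /esym/eqP := detE n np; rewrite det_eq0 => /eqP; apply/eqP/prodf_neq0 => k _.
  exact: point_det0.
move=> eps eps0; have [M mM] := mP _ eps0; exists M.+1 => -[//|n] Mn np.
(* The logarithm turns the product formula for the determinant into the Snirelman sum, so the two
   sequences agree term by term. *)
suff -> : lg (c n.+1)%:R =
    \sum_(k : {ffun 'I_d -> 'I_n.+1}) lg (\det (lpoly_eval a S (root_point xi k))).
  by apply: mM => //; apply: ltnW.
rewrite -(lg_prod lgP) => [|k]; last exact: point_det0.
by rewrite -detE // (lg_absz p_prime avP lgP).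
Qed.
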